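(* Fix $\alpha\in(0,1)$, $\sigma>0$, $\kappa>0$, a positive sequence $C_n\to\infty$ (used in the definition of the confusion set), dimensions $d=d_n\ge 2$ that may vary arbitrarily with $n$, and an index $r\in[d]$. For any $\tau\in\{0,1,\dots,d-2\}$ (possibly depending on $n$), suppose that $\varepsilon=\varepsilon_n\ge C_n'\varepsilon^\star(\tau)$, where $C_n'$ is any positive sequence with $C_n'\to\infty$ as $n\to\infty$ and $$\varepsilon^\star(\tau)=\sqrt{\frac{1\vee\log\tau}{n}}.$$ Then, for $\widehat s=\widehat s_{\mathrm{plug}}$ and for $\widehat s=\widehat s_{\mathrm{adj}}$, the DA argmin test has asymptotic uniform power one: $$\lim_{n\to\infty}\ \inf_{P\in\mathcal{P}_{1,r}(\varepsilon;\tau)}P\Bigl(\sqrt n\,\bm\gamma_{\widehat s}^\top\overline{\bm X}^{(1)}>z_{1-\alpha}\sqrt{\bm\gamma_{\widehat s}^\top\widehat{\bm\Sigma}^{(1)}\bm\gamma_{\widehat s}}\Bigr)=1 .$$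
   Context: Notation: $[d]=\{1,\dots,d\}$; $\bm X_1,\dots,\bm X_{2n}$ are i.i.d. from $P$ on $\mathbb{R}^d$ with mean $\bm\mu=(\mu_1,\dots,\mu_d)^\top$; $z_{1-\alpha}$ is the $1-\alpha$ standard normal quantile; $a\vee b=\max(a,b)$, and $1\vee\log 0=1$; $\bm\gamma_k=\bm e_r-\bm e_k$ with $\bm e_k$ the standard basis vectors. ''sargmin'' is the smallest index attaining the minimum. An infimum over an empty class is taken to be $1$. $\overline{\bm X}^{(1)}$, $\widehat{\bm\Sigma}^{(1)}$ are the sample mean and sample covariance matrix of $\bm X_1,\dots,\bm X_n$, and $\overline{\bm X}^{(2)}$, $\widehat{\bm\Sigma}^{(2)}$ those of $\bm X_{n+1},\dots,\bm X_{2n}$. Selection rules, with $\kappa>0$ a fixed constant: $$\widehat s_{\mathrm{plug}}=\mathop{\mathrm{sargmin}}_{k\in[d]\setminus\{r\}}\overline X^{(2)}_k,\qquad \widehat s_{\mathrm{adj}}=\mathop{\mathrm{sargmin}}_{k\in[d]\setminus\{r\}}\frac{\overline X^{(2)}_k-\overline X^{(2)}_r}{\sqrt{\bm\gamma_k^\top\widehat{\bm\Sigma}^{(2)}\bm\gamma_k}\vee\kappa}.$$ Let $\mu_\star=\min_{k\in[d]}\mu_k$ and $\Theta_{-r}=\arg\min_{k\in[d]\setminus\{r\}}\mu_k$ (set of all minimizers). The confusion set is $$\mathbb{C}_r=\Bigl\{k\in[d]\setminus(\{r\}\cup\Theta_{-r}):\ \tfrac{\mu_r-\mu_\star}{2}\le\mu_k-\mu_\star\le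 C_n\sqrt{\tfrac{\log d}{n}}\Bigr\}.$$ $\mathcal{P}$ is the class of distributions on $\mathbb{R}^d$ that are sub-Gaussian with variance proxy $\sigma^2$: $\mathbb{E}_P[\exp(\lambda\langle\bm v,\bm X-\bm\mu\rangle)]\le\exp(\lambda^2\sigma^2/2)$ for all $\lambda\in\mathbb{R}$ and all unit vectors $\bm v$. For $\varepsilon>0$, $$\mathcal{P}_{1,r}(\varepsilon;\tau)=\{P\in\mathcal{P}:\ \mu_r-\mu_\star\ge\varepsilon\ \text{and}\ |\mathbb{C}_r|=\tau\}.$$ *)

(* Defs.v *)
From HB Require Import structures.
From mathcomp Require Export all_boot all_order all_algebra.
From mathcomp Require Export all_classical all_reals all_analysis.
Set Implicit Arguments.
Unset Strict Implicit.
Unset Printing Implicit Defensive.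
Export Order.TTheory GRing.Theory Num.Theory.
Export numFieldNormedType.Exports.

#[global] Open Scope classical_set_scope.
#[global] Open Scope ring_scope.

(* The product measure is built by recursion, as the image of
   P \x P^n under (x, t) |-> x :: t; [iid_box] is its characterization. *)
Section iid.
Context (d : measure_display) (T : measurableType d) (R : realType).

Definition tuple_cons n (x : T * n.-tuple T) : n.+1.-tuple T :=
  [the n.+1.-tuple T of x.1 :: x.2].

Lemma measurable_tuple_cons n : measurable_fun setT (@tuple_cons n).
Proof. exact: measurable_cons. Qed.

HB.instance Definition _ n :=
  isMeasurableFun.Build _ _ _ _ (@tuple_cons n) (@measurable_tuple_cons n).

Fixpoint iid (P : probability T R) n : probability (n.-tuple T) R :=
  match n with
  | 0 => dirac (nil_tuple T)
  | n'.+1 => distribution (P \x iid P n')%E (@tuple_cons n')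
  end.

Lemma iid_box (P : probability T R) n (A : 'I_n -> set T) :
  (forall i, measurable (A i)) ->
  iid P n [set t | forall i, A i (tnth t i)] = (\prod_(i < n) P (A i))%E.
Proof.
elim: n A => [|n IHn] A mA /=.
  rewrite big_ord0 diracE mem_set//= => i; by case: i.
rewrite big_ord_recl -IHn// /distribution /pushforward.
rewrite -product_measure1E//.
- congr (product_measure1 _ _ _); apply/seteqP; split => -[x t] /=.
    move=> h; split; first by have := h ord0.
    by move=> i; have := h (lift ord0 i); rewrite tnthS.
  move=> [hx ht] i; have [j ->|->] := unliftP ord0 i; last by [].
  by rewrite tnthS.
- rewrite (_ : mkset _ =
    \bigcap_(i in [set: 'I_n]) ((fun t => tnth t i) @^-1` A (lift ord0 i))).
    apply: fin_bigcap_measurable => // i _; rewrite -[X in measurable X]setTI.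
    exact: measurable_tnth.
  by apply/seteqP; split => t /= h i; [move=> _|]; exact: h.
Qed.

End iid.

(* A point of R^d is a d.-tuple R, whose sigma-algebra is the product (Borel)
   one; [colv] gives the corresponding column vector. *)
Section linear_algebra.
Context (R : realType) (d : nat).
Implicit Types u v : 'cV[R]_d.

Definition colv (x : d.-tuple R) : 'cV[R]_d := \col_k tnth x k.

Definition dotv u v : R := (u^T *m v) 0 0.

Definition qform (S : 'M[R]_d) u : R := (u^T *m S *m u) 0 0.

Definition gammav (r k : 'I_d) : 'cV[R]_d := delta_mx r 0 - delta_mx k 0.

End linear_algebra.

Section sample_statistics.
Context (R : realType) (d n : nat).
Implicit Types X : 'I_n -> 'cV[R]_d.

Definition sample_mean X : 'cV[R]_d := n%:R^-1 *: \sum_(i < n) X i.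

Definition sample_cov X : 'M[R]_d :=
  (n.-1)%:R^-1 *:
    \sum_(i < n) (X i - sample_mean X) *m (X i - sample_mean X)^T.

Definition half1 (w : (n + n).-tuple (d.-tuple R)) (i : 'I_n) : 'cV[R]_d :=
  colv (tnth w (lshift n i)).

Definition half2 (w : (n + n).-tuple (d.-tuple R)) (i : 'I_n) : 'cV[R]_d :=
  colv (tnth w (rshift n i)).

End sample_statistics.

Section argmin.
Context (R : realType) (d : nat) (r : 'I_d) (F : 'I_d -> R).

Definition argmin_except : {set 'I_d} :=
  [set k | k != r & [forall j, (j != r) ==> (F k <= F j)]].

(* The default value r is only reached when d = 1. *)
Definition sargmin_except : 'I_d :=
  odflt r [pick k in argmin_except |
            [forall j in argmin_except, (k <= j)%N]].

End argmin.

Section selection.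
Context (R : realType) (d n : nat).
Implicit Types w : (n + n).-tuple (d.-tuple R).

Definition s_plug (r : 'I_d) w : 'I_d :=
  sargmin_except r (fun k => sample_mean (half2 w) k 0).

Definition s_adj (kappa : R) (r : 'I_d) w : 'I_d :=
  sargmin_except r (fun k =>
    (sample_mean (half2 w) k 0 - sample_mean (half2 w) r 0) /
    Num.max (Num.sqrt (qform (sample_cov (half2 w)) (gammav R r k))) kappa).

End selection.
Arguments s_plug {R d} n r w.
Arguments s_adj {R d} n kappa r w.

(* Quantile function of N(0, 1), as the generalized inverse of its cdf. *)
Definition normal_quantile (R : realType) (p : R) : R :=
  inf [set x : R | (p%:E <= normal_prob 0 1 `]-oo, x])%E].

Definition rejection (R : realType) (d n : nat) (alpha : R) (r : 'I_d)
    (s : (n + n).-tuple (d.-tuple R) -> 'I_d) :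
    set ((n + n).-tuple (d.-tuple R)) :=
  [set w | Num.sqrt n%:R * dotv (gammav R r (s w)) (sample_mean (half1 w)) >
           normal_quantile (1 - alpha) *
           Num.sqrt (qform (sample_cov (half1 w)) (gammav R r (s w)))].

Arguments rejection {R d} n alpha r s _.

Section distribution_classes.
Context (R : realType) (d : nat).
Implicit Types (P : probability (d.-tuple R) R) (r : 'I_d).

Definition meanv P : 'cV[R]_d := \col_k fine 'E_P[fun x => tnth x k].

Definition subgaussian (sigma : R) P : Prop :=
  (forall k, P.-integrable setT (fun x => (tnth x k)%:E)) /\
  forall (lambda : R) (v : 'cV[R]_d), dotv v v = 1 ->
    ('E_P[fun x => expR (lambda * dotv v (colv x - meanv P))] <=
      (expR (lambda ^+ 2 * sigma ^+ 2 / 2))%:E)%E.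

(* The seed of the iterated minimum is one of its terms. *)
Definition mu_min r P : R := \big[Num.min/meanv P r 0]_(k < d) meanv P k 0.

Definition confusion_set (n : nat) (c : R) r P : {set 'I_d} :=
  [set k | [&& k != r, k \notin argmin_except r (fun j => meanv P j 0),
    (meanv P r 0 - mu_min r P) / 2 <= meanv P k 0 - mu_min r P &
    meanv P k 0 - mu_min r P <= c * Num.sqrt (ln d%:R / n%:R)]].

Definition alternatives (n : nat) (sigma c : R) r (eps : R) (tau : nat) :
    set (probability (d.-tuple R) R) :=
  [set P | [/\ subgaussian sigma P, meanv P r 0 - mu_min r P >= eps &
             #|confusion_set n c r P| = tau]].

(* Infimum over the class of the probability of A under the law of m i.i.d.
   draws; equal to 1 on the empty class (where ereal_inf would give +oo). *)
Definition inf_prob (m : nat) (C : set (probability (d.-tuple R) R))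
    (A : set (m.-tuple (d.-tuple R))) : \bar R :=
  if C == set0 then 1%E else ereal_inf [set iid P m A | P in C].

End distribution_classes.

(* ln 0 = 0, so that the maximum is 1 for tau = 0. *)
Definition eps_star (R : realType) (n tau : nat) : R :=
  Num.sqrt (Num.max 1 (ln tau%:R) / n%:R).

(* Main.v *)
From mathcomp Require Import measurable_realfun ring lra.
Require Import Defs.
Set Implicit Arguments.
Unset Strict Implicit.
Unset Printing Implicit Defensive.

(** Splitting the sample makes the selected index [s] independent of the first
    half, so the miss probability is at most that of selecting a bad index plus
    the worst conditional miss probability at a good one.  Both selection rules
    minimise a score [(mean_k - mean_r) / D_k] with [kappa <= D_k], and [D_k] is
    at most some constant [M] with probability close to one.  Put
    [gap = mu_r - mu_min] and [c = kappa / (4 M)], and call [k] bad when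
    [mu_r - mu_k < c * gap].  A bad [k] can only beat a minimiser of the mean if
    [mean_k - mean_r] deviates by [c * a], where [a = mu_k - mu_min >= gap / 2];
    by the sub-Gaussian tail this has probability at most
    [exp (- n c^2 a^2 / (4 sigma^2))].  Either [k] belongs to the confusion set,
    and [n gap^2 >= C'^2 max(1, log tau)] beats the [tau] such indices, or
    [a > C sqrt (log d / n)], which beats the at most [d] others.  At a good
    index the signal is [sqrt n * c * gap], which exceeds both the noise of the
    mean (sub-Gaussian tail) and the studentised threshold (Markov's inequality
    for the sample variance). *)

(** * Finite unions and Markov's inequality *)

Section probability_bounds.
Context (dT : measure_display) (T : measurableType dT) (R : realType).
Variable P : probability T R.

Lemma integral_probability_cst (c : \bar R) : (\int[P]_x c = c)%E.
Proof. by rewrite integral_cst//= probability_setT mule1. Qed.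

Lemma le_probability (A B : set T) : measurable A -> measurable B ->
  A `<=` B -> (P A <= P B)%E.
Proof. by move=> mA mB AB; apply: le_measure => //; exact: mem_set. Qed.

Lemma measurable_fin_exists (I : finType) (Q : pred I) (F : I -> set T) :
  (forall i, Q i -> measurable (F i)) ->
  measurable [set x | exists2 i, Q i & F i x].
Proof.
move=> mF; rewrite (_ : mkset _ = \bigcup_(i in [set i | Q i]) F i).
  by apply: fin_bigcup_measurable.
by apply/seteqP; split => x [i Qi Fi]; exists i.
Qed.

Lemma union_bound (I : finType) (Q : pred I) (F : I -> set T) :
  (forall i, Q i -> measurable (F i)) ->
  (P [set x | exists2 i, Q i & F i x] <= \sum_(i | Q i) P (F i))%E.
Proof.
move=> mF; rewrite (_ : mkset _ = \big[setU/set0]_(i | Q i) F i).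
  suff [] : measurable (\big[setU/set0]_(i | Q i) F i) /\
    (P (\big[setU/set0]_(i | Q i) F i) <= \sum_(i | Q i) P (F i))%E by [].
  elim/big_rec2: _ => [|i a A Qi [mA PA]]; first by split => //; rewrite measure0.
  split; first by apply: measurableU => //; exact: mF.
  apply: (le_trans (measureU2 _ (mF _ Qi) mA)).
  by rewrite leeD2l.
rewrite -bigcup_seq_cond; apply/seteqP; split => x.
  by case=> i Qi Fi; exists i => //=; rewrite mem_index_enum.
by case=> i /= /andP[_ Qi] Fi; exists i.
Qed.

Lemma markov_ineq (f : T -> R) (a : R) : measurable_fun setT f ->
  (forall x, 0 <= f x) -> 0 < a ->
  (P [set x | a <= f x]%R <= (a^-1)%:E * \int[P]_x (f x)%:E)%E.
Proof.
move=> mf f0 a0.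
rewrite lee_pdivlMl//.
have /= := @le_integral_comp_abse _ _ _ P setT measurableT (EFin \o f) a id
  (@measurable_id _ _ _) (fun _ h => h) (fun _ _ _ _ h => h).
move=> /(_ _ a0) h; apply: (le_trans _ (le_trans (h _) _)).
- rewrite setTI le_eqVlt; apply/orP; left; apply/eqP; congr (_ * P _)%E.
  by apply/seteqP; split => x /=; rewrite lee_fin ger0_norm.
- exact/measurable_EFinP.
- by rewrite le_eqVlt; apply/orP; left; apply/eqP; apply: eq_integral => x _;
    rewrite /= ger0_norm.
Qed.

End probability_bounds.

(** * Product measures: independence of the two blocks, products and sums *)

Section iid_theory.
Context (dT : measure_display) (T : measurableType dT) (R : realType).
Variable P : probability T R.
Local Open Scope ereal_scope.

Definition tuple_left n m (w : (n + m).-tuple T) : n.-tuple T :=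
  [tuple tnth w (lshift m i) | i < n].

Definition tuple_right n m (w : (n + m).-tuple T) : m.-tuple T :=
  [tuple tnth w (rshift n i) | i < m].

Lemma measurable_tuple_left n m : measurable_fun setT (@tuple_left n m).
Proof.
apply/measurable_fun_tnthP => i.
rewrite (_ : _ \o _ = fun w : (n + m).-tuple T => tnth w (lshift m i)).
  exact: measurable_tnth.
by apply/funext => w /=; rewrite tnth_mktuple.
Qed.

Lemma measurable_tuple_right n m : measurable_fun setT (@tuple_right n m).
Proof.
apply/measurable_fun_tnthP => i.
rewrite (_ : _ \o _ = fun w : (n + m).-tuple T => tnth w (rshift n i)).
  exact: measurable_tnth.
by apply/funext => w /=; rewrite tnth_mktuple.
Qed.

Lemma ge0_integral_iidS n (f : n.+1.-tuple T -> \bar R) :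
  measurable_fun setT f -> (forall t, 0 <= f t) ->
  \int[iid P n.+1]_t f t = \int[P]_x \int[iid P n]_t f (tuple_cons (x, t)).
Proof.
move=> mf f0; rewrite /= ge0_integral_distribution//.
rewrite fubini_tonelli1//=.
by apply: measurableT_comp => //; exact: measurable_tuple_cons.
Qed.

Lemma tuple_left_cons n m (x : T) (t : (n + m).-tuple T) :
  tuple_left (tuple_cons (x, t) : (n.+1 + m).-tuple T) = tuple_cons (x, tuple_left t).
Proof.
apply: eq_from_tnth => i; rewrite tnth_mktuple.
have [j ->|->] := unliftP ord0 i; last by rewrite !(tnth_nth x).
by rewrite !(tnth_nth x) /= -(tnth_nth x (tuple_left t) j) tnth_mktuple (tnth_nth x).
Qed.

Lemma tuple_right_cons n m (x : T) (t : (n + m).-tuple T) :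
  tuple_right (tuple_cons (x, t) : (n.+1 + m).-tuple T) = tuple_right t.
Proof. by apply: eq_from_tnth => i; rewrite !tnth_mktuple !(tnth_nth x). Qed.

Lemma iidSE n (A : set (n.+1.-tuple T)) :
  iid P n.+1 A = \int[P]_x iid P n [set t | A (tuple_cons (x, t))].
Proof.
apply: eq_integral => x _ /=; congr (iid P n _).
by apply/seteqP; split => t; rewrite /xsection /= inE.
Qed.

Lemma measurable_cons_section n (A : set (n.+1.-tuple T)) x :
  measurable A -> measurable [set t | A (tuple_cons (x, t))].
Proof.
move=> mA; rewrite -[X in measurable X]setTI.
by apply: (measurable_cons (f := cst x) (g := id)).
Qed.

(** This is the independence behind sample splitting. Induction on [n] peels off the first
    observation, which lies in the left block: [A] is replaced by its section there, while [B] is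
    untouched. *)
Lemma iid_left_right n m (A : set (n.-tuple T)) (B : set (m.-tuple T)) :
  measurable A -> measurable B ->
  iid P (n + m) [set w | A (tuple_left w) /\ B (tuple_right w)] =
  iid P n A * iid P m B.
Proof.
move=> + mB; elim: n A => [|n IHn] A mA.
  rewrite [iid P 0 A]diracE.
  (* With an empty left block, the condition on [A] either always holds or never does. *)
  have lE (w : (0 + m).-tuple T) : tuple_left w = nil_tuple T by exact: tuple0.
  have rE (w : (0 + m).-tuple T) : tuple_right w = w.
    by apply: eq_from_tnth => i; rewrite tnth_mktuple; congr tnth; exact: val_inj.
  have [/set_mem A0|/negP A0] := boolP (_ \in A).
    rewrite mul1e; congr (iid P m _); apply/seteqP; split => w /=.
      by rewrite rE => -[].
    by rewrite lE rE; split.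
  rewrite mul0e (_ : mkset _ = set0) ?measure0//.
  by apply/seteqP; split => w //= []; rewrite lE => /mem_set.
rewrite [iid P n.+1 A]iidSE [LHS](iidSE (n := n + m)).
rewrite -ge0_integralZr//; last first.
  (* Pulling [A] back along [tuple_cons] turns the inner probability into that of a section of a
     product set, hence a measurable function of [x]. *)
  pose A' := tuple_cons (n := n) @^-1` A.
  have mA' : measurable A'.
    by rewrite -[A']setTI; exact: measurable_tuple_cons.
  rewrite (_ : (fun _ => _) = iid P n \o xsection A'); first exact: measurable_fun_xsection.
  apply/funext => x /=; congr (iid P n _).
  by apply/seteqP; split => t; rewrite /xsection /= inE.
apply: eq_integral => x _; rewrite -IHn; last exact: measurable_cons_section.
congr (iid P _ _); apply/seteqP; split => t /=.
  by rewrite tuple_left_cons tuple_right_cons.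
by rewrite tuple_left_cons tuple_right_cons.
Qed.

(** Applied to exponentials, this factorises the moment generating function of a sum in the Chernoff
    bound [mean_diff_tail]. *)
Lemma integral_iid_prod n (f : T -> R) :
  measurable_fun setT f -> (forall x, (0 <= f x)%R) ->
  \int[iid P n]_t (\prod_(i < n) f (tnth t i))%R%:E = (\int[P]_x (f x)%:E) ^+ n.
Proof.
move=> mf f0; elim: n => [|n IHn].
  under eq_integral do rewrite big_ord0.
  exact: integral_probability_cst.
have mp k : measurable_fun setT (fun t : k.-tuple T => \prod_(i < k) f (tnth t i))%R.
  apply: measurable_prod => i _; apply: (measurableT_comp (f := f)) => //.
  exact: measurable_tnth.
have p0 k (t : k.-tuple T) : (0 <= \prod_(i < k) f (tnth t i))%R.
  by apply: prodr_ge0.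
rewrite ge0_integral_iidS; first last.
- by move=> t; rewrite lee_fin.
- by apply/measurable_EFinP; exact: mp.
transitivity (\int[P]_x ((f x)%:E * (\int[P]_x (f x)%:E) ^+ n)).
  apply: eq_integral => x _; rewrite -IHn -ge0_integralZl//.
  - by apply: eq_integral => t _; rewrite big_ord_recl EFinM; congr (_ * _%:E);
      apply: eq_bigr => i _; rewrite tnthS.
  - by apply/measurable_EFinP; exact: mp.
  - by move=> t _; rewrite lee_fin.
  - by rewrite lee_fin.
rewrite ge0_integralZr//.
- by rewrite expeS.
- exact/measurable_EFinP.
- by move=> t _; rewrite lee_fin.
- by apply: expe_ge0; apply: integral_ge0 => x _; rewrite lee_fin.
Qed.

Lemma integral_iid_sum n (f : T -> R) :
  measurable_fun setT f -> (forall x, (0 <= f x)%R) ->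
  \int[iid P n]_t (\sum_(i < n) f (tnth t i))%R%:E = (\int[P]_x (f x)%:E) *+ n.
Proof.
move=> mf f0; elim: n => [|n IHn].
  under eq_integral do rewrite big_ord0.
  exact: integral_probability_cst.
have mp k : measurable_fun setT (fun t : k.-tuple T => \sum_(i < k) f (tnth t i))%R.
  apply: measurable_sum => i; apply: (measurableT_comp (f := f)) => //.
  exact: measurable_tnth.
have p0 k (t : k.-tuple T) : (0 <= \sum_(i < k) f (tnth t i))%R.
  by apply: sumr_ge0.
rewrite ge0_integral_iidS; first last.
- by move=> t; rewrite lee_fin.
- by apply/measurable_EFinP; exact: mp.
transitivity (\int[P]_x ((f x)%:E + (\int[P]_x (f x)%:E) *+ n)).
  apply: eq_integral => x _; rewrite -IHn.
  under eq_integral => t _.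
    rewrite big_ord_recl EFinD tnth0.
    under eq_bigr do rewrite tnthS.
    over.
  rewrite ge0_integralD//=; first last.
  - by apply/measurable_EFinP; exact: mp.
  - by move=> t _; rewrite lee_fin; exact: p0.
  - by move=> t _; rewrite lee_fin.
  by rewrite integral_probability_cst.
have I0 : 0 <= (\int[P]_x (f x)%:E) *+ n.
  by rewrite -IHn; apply: integral_ge0 => x _; rewrite lee_fin.
rewrite ge0_integralD//; first last.
- exact/measurable_EFinP.
- by move=> t _; rewrite lee_fin.
by rewrite integral_probability_cst muleS.
Qed.

End iid_theory.

(** * Contrasts of two coordinates: sub-Gaussian tails and sample variance *)

Section pairwise_differences.
Context (R : realType) (d : nat).
Implicit Types (j k : 'I_d) (x : d.-tuple R).

(** The test and both selection rules see the data only through contrasts along [gammav], so vectors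
    and covariance matrices reduce to the scalar statistics [mean_diff] and [var_diff]. *)
Definition coord_diff j k x : R := tnth x j - tnth x k.

Definition mean_diff n j k (t : n.-tuple (d.-tuple R)) : R :=
  n%:R^-1 * \sum_(i < n) coord_diff j k (tnth t i).

Definition var_diff n j k (t : n.-tuple (d.-tuple R)) : R :=
  (n.-1)%:R^-1 * \sum_(i < n) (coord_diff j k (tnth t i) - mean_diff j k t) ^+ 2.

Lemma measurable_coord_diff j k : measurable_fun setT (coord_diff j k).
Proof. by apply: measurable_funB; exact: measurable_tnth. Qed.

Lemma measurable_mean_diff n j k : measurable_fun setT (@mean_diff n j k).
Proof.
apply: measurable_funM => //; apply: measurable_sum => i.
apply: (measurableT_comp (f := coord_diff j k)); first exact: measurable_coord_diff.
exact: measurable_tnth.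
Qed.

Lemma measurable_var_diff n j k : measurable_fun setT (@var_diff n j k).
Proof.
apply: measurable_funM => //; apply: measurable_sum => i.
apply: measurable_funX; apply: measurable_funB; last exact: measurable_mean_diff.
apply: (measurableT_comp (f := coord_diff j k)); first exact: measurable_coord_diff.
exact: measurable_tnth.
Qed.

Lemma var_diff_ge0 n j k (t : n.-tuple (d.-tuple R)) : 0 <= var_diff j k t.
Proof. by apply: mulr_ge0 => //; apply: sumr_ge0 => i _; exact: sqr_ge0. Qed.

Lemma dotv_gammav j k (u : 'cV[R]_d) : dotv (gammav R j k) u = u j 0 - u k 0.
Proof.
by rewrite /dotv /gammav linearB /= !trmx_delta mulmxBl -!rowE !mxE.
Qed.

Lemma dotv_gammav_gammav j k : j != k -> dotv (gammav R j k) (gammav R j k) = 2.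
Proof.
move=> jk; rewrite dotv_gammav !mxE !eqxx (negbTE jk) eq_sym (negbTE jk) /=.
by rewrite subr0 sub0r opprK.
Qed.

Lemma dotvZl (a : R) (u v : 'cV[R]_d) : dotv (a *: u) v = a * dotv u v.
Proof. by rewrite /dotv linearZ /= -scalemxAl mxE. Qed.

Lemma dotvZr (a : R) (u v : 'cV[R]_d) : dotv u (a *: v) = a * dotv u v.
Proof. by rewrite /dotv -scalemxAr mxE. Qed.

Lemma sample_meanE n (X : 'I_n -> 'cV[R]_d) k :
  sample_mean X k 0 = n%:R^-1 * \sum_(i < n) X i k 0.
Proof. by rewrite /sample_mean mxE summxE. Qed.

Lemma sample_mean_diff n (t : n.-tuple (d.-tuple R)) j k :
  sample_mean (fun i => colv (tnth t i)) j 0 -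
  sample_mean (fun i => colv (tnth t i)) k 0 = mean_diff j k t.
Proof.
rewrite !sample_meanE -mulrBr -sumrB; congr (_ * _).
by apply: eq_bigr => i _; rewrite !mxE.
Qed.

Lemma mean_diffC n j k (t : n.-tuple (d.-tuple R)) :
  mean_diff k j t = - mean_diff j k t.
Proof. by rewrite -!sample_mean_diff opprB. Qed.

(** Each rank-one term of the covariance contributes the square of one inner product with
    [gammav]. *)
Lemma qform_sample_cov n (t : n.-tuple (d.-tuple R)) j k :
  qform (sample_cov (fun i => colv (tnth t i))) (gammav R j k) =
  var_diff j k t.
Proof.
rewrite /qform /sample_cov /var_diff -scalemxAr -scalemxAl mxE; congr (_ * _).
rewrite mulmx_sumr mulmx_suml summxE; apply: eq_bigr => i _.
set u := _ - _; have -> : coord_diff j k (tnth t i) - mean_diff j k t =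
    dotv (gammav R j k) u.
  rewrite dotv_gammav -sample_mean_diff /u /coord_diff !mxE; ring.
rewrite mulmxA -(mulmxA ((gammav R j k)^T *m u)) mxE big_ord1 expr2; congr (_ * _).
by rewrite /dotv -[u^T *m _]trmxK trmx_mul trmxK mxE.
Qed.

(** By symmetry take [y >= 0]; then [1 + y ^+ 2 / 2 <= expR y]. The inequality turns exponential
    moments into a second moment. *)
Lemma sqr_le_expRD (y : R) : y ^+ 2 <= 2 * (expR y + expR (- y)).
Proof.
wlog y0 : y / 0 <= y => [h|].
  have [|/ltW y0] := leP 0 y; first exact: h.
  by rewrite addrC -[in X in _ + X](opprK y) -sqrrN; apply: h; rewrite oppr_ge0.
have := expR_ge1Dxn 1 y0; have := expR_gt0 (- y).
by rewrite (_ : 2`!%:R = 2 :> R)//; lra.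
Qed.

Section subgaussian.
Variables (sigma : R) (P : probability (d.-tuple R) R).
Hypotheses (sigma_gt0 : 0 < sigma) (subP : subgaussian sigma P).
Local Notation delta j k := (meanv P j 0 - meanv P k 0).

(** The vector [gammav] has norm [Num.sqrt 2]; normalising it moves this factor into [l], so the
    variance proxy of a contrast is twice [sigma ^+ 2]. *)
Lemma subgaussian_mgf j k (l : R) : j != k ->
  (\int[P]_x (expR (l * (coord_diff j k x - delta j k)))%:E <=
   (expR (l ^+ 2 * sigma ^+ 2))%:E)%E.
Proof.
move=> jk; have [_ /(_ (l * Num.sqrt 2) ((Num.sqrt 2)^-1 *: gammav R j k))] := subP.
have s2 : Num.sqrt 2 != 0 :> R by rewrite sqrtr_eq0 -ltNge.
have s22 : Num.sqrt 2 * Num.sqrt 2 = 2 :> R by rewrite -expr2 sqr_sqrtr.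
rewrite dotvZl dotvZr dotv_gammav_gammav// => /(_ _)/wrap[].
  by rewrite mulrA -[X in _ * X]s22; field.
rewrite unlock => h; apply: le_trans (le_trans h _).
  rewrite le_eqVlt; apply/orP; left; apply/eqP; apply: eq_integral => x _.
  congr (expR _)%:E; rewrite dotvZl dotv_gammav !mxE /coord_diff; field.
  exact: s2.
rewrite (_ : _ * _ / 2 = l ^+ 2 * sigma ^+ 2)//.
by rewrite exprMn sqr_sqrtr//; field.
Qed.

(** Apply [sqr_le_expRD] to the centred contrast divided by [sigma]. At [l] equal to plus or minus
    [sigma^-1] the moment generating function is at most [expR 1], and [2 * (expR 1 + expR 1)] gives
    the constant. *)
Lemma subgaussian_variance j k : j != k ->
  (\int[P]_x ((coord_diff j k x - delta j k) ^+ 2)%:E <=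
   (4 * expR 1 * sigma ^+ 2)%:E)%E.
Proof.
move=> jk; pose Y x := coord_diff j k x - delta j k.
have mY : measurable_fun setT Y.
  by apply: measurable_funB => //; exact: measurable_coord_diff.
have mE (l : R) : measurable_fun setT (fun x => (expR (l * Y x))%:E).
  apply/measurable_EFinP; apply: (measurableT_comp (f := expR)) => //.
  exact: measurable_funM.
have s0 : sigma != 0 by rewrite gt_eqF.
apply: (@le_trans _ _ (\int[P]_x ((2 * sigma ^+ 2)%:E *
    ((expR (sigma^-1 * Y x))%:E + (expR (- sigma^-1 * Y x))%:E)))%E).
  apply: ge0_le_integral => //.
  - by move=> x _; rewrite lee_fin sqr_ge0.
  - by apply/measurable_EFinP; exact: measurable_funX.
  - by apply: emeasurable_funM => //; apply: emeasurable_funD.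
  - move=> x _; rewrite -EFinD -EFinM lee_fin -/(Y x) mulNr.
    rewrite -mulrA mulrCA -ler_pdivrMl ?exprn_gt0// -exprVn -exprMn.
    exact: sqr_le_expRD.
rewrite ge0_integralZl//; last 3 first.
- exact: emeasurable_funD.
- by move=> x _; rewrite adde_ge0 ?lee_fin ?expR_ge0.
- by rewrite lee_fin mulr_ge0 ?sqr_ge0.
rewrite ge0_integralD//.
rewrite muleC (_ : 4 * expR 1 * _ = (expR 1 + expR 1) * (2 * sigma ^+ 2)); last by ring.
rewrite [X in (_ <= X)%E]EFinM lee_wpmul2r ?lee_fin ?mulr_ge0 ?(ltW sigma_gt0)// EFinD leeD//.
- apply: le_trans (subgaussian_mgf _ jk) _.
  by rewrite lee_fin ler_expR exprVn mulVf ?expf_neq0.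
- apply: le_trans (subgaussian_mgf _ jk) _.
  by rewrite lee_fin ler_expR sqrrN exprVn mulVf ?expf_neq0.
Qed.

(** Chernoff bound. The value [l = a / (2 * sigma ^+ 2)] maximises [l * a - l ^+ 2 * sigma ^+ 2],
    with maximum [a ^+ 2 / (4 * sigma ^+ 2)]. *)
Lemma mean_diff_tail n j k (a : R) : (0 < n)%N -> j != k -> 0 < a ->
  (iid P n [set t | a <= mean_diff j k t - delta j k]%R <=
   (expR (- (n%:R * a ^+ 2 / (4 * sigma ^+ 2))))%:E)%E.
Proof.
move=> n0 jk a0; pose l := a / (2 * sigma ^+ 2).
have s0 : sigma != 0 by rewrite gt_eqF.
have l0 : 0 < l by rewrite divr_gt0 ?mulr_gt0 ?exprn_gt0.
pose f x := expR (l * (coord_diff j k x - delta j k)).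
have mf : measurable_fun setT f.
  apply: (measurableT_comp (f := expR)) => //; apply: measurable_funM => //.
  by apply: measurable_funB => //; exact: measurable_coord_diff.
have mp : measurable_fun setT (fun t : n.-tuple (d.-tuple R) => \prod_(i < n) f (tnth t i)).
  apply: measurable_prod => i _; apply: (measurableT_comp (f := f)) => //.
  exact: measurable_tnth.
have fE (t : n.-tuple (d.-tuple R)) :
    \prod_(i < n) f (tnth t i) = expR (l * (n%:R * (mean_diff j k t - delta j k))).
  rewrite -expR_sum -mulr_sumr sumrB sumr_const card_ord; congr (expR (_ * _)).
  by rewrite mulrBr /mean_diff mulrA divff ?mul1r ?mulr_natl// pnatr_eq0 -lt0n.

have -> : [set t : n.-tuple (d.-tuple R) | a <= mean_diff j k t - delta j k] =
    [set t | expR (l * (n%:R * a)) <= \prod_(i < n) f (tnth t i)].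
  by apply/seteqP; split => t /=; rewrite fE ler_expR !ler_pM2l// ltr0n.
apply: le_trans (markov_ineq (iid P n) mp _ (expR_gt0 _)) _.
  by move=> t; apply: prodr_ge0 => i _; exact: expR_ge0.
rewrite integral_iid_prod//; last by move=> x; exact: expR_ge0.
apply: (@le_trans _ _ ((expR (l * (n%:R * a)))^-1%:E *
   (expR (n%:R * (l ^+ 2 * sigma ^+ 2)))%:E)%E).
  rewrite lee_wpmul2l ?lee_fin ?invr_ge0 ?expR_ge0//.
  rewrite expRM_natl EFin_expe.
  have I0 : (0 <= \int[P]_x (f x)%:E)%E.
    by apply: integral_ge0 => x _; rewrite lee_fin expR_ge0.
  elim: (n) => [//|m IHm]; rewrite !expeS lee_pmul ?expe_ge0//.
  exact: subgaussian_mgf.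
rewrite -EFinM -expRN -expRD lee_fin ler_expR le_eqVlt; apply/orP; left; apply/eqP.
by rewrite /l; field.
Qed.

(** Centring at the true mean instead of the sample mean only increases the sum of squares; the
    factor [n / (n - 1) <= 2] then doubles the constant of [subgaussian_variance]. *)
Lemma integral_var_diff n j k : (1 < n)%N -> j != k ->
  (\int[iid P n]_t (var_diff j k t)%:E <= (8 * expR 1 * sigma ^+ 2)%:E)%E.
Proof.
move=> n1 jk; pose f x := (coord_diff j k x - delta j k) ^+ 2.
have mf : measurable_fun setT f.
  apply: measurable_funX; apply: measurable_funB => //; exact: measurable_coord_diff.
have f0 x : 0 <= f x by exact: sqr_ge0.
have n0 : n%:R != 0 :> R by rewrite pnatr_eq0 -lt0n (ltn_trans _ n1).
have mS : measurable_fun setT (fun t : n.-tuple (d.-tuple R) => \sum_(i < n) f (tnth t i)).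
  apply: measurable_sum => i; apply: (measurableT_comp (f := f)) => //.
  exact: measurable_tnth.
apply: (@le_trans _ _ (\int[iid P n]_t
    ((n.-1)%:R^-1%:E * (\sum_(i < n) f (tnth t i))%:E))%E).
  apply: ge0_le_integral => //.
  - by move=> t _; rewrite lee_fin var_diff_ge0.
  - by apply/measurable_EFinP; exact: measurable_var_diff.
  - by apply: emeasurable_funM => //; apply/measurable_EFinP; exact: mS.
  - move=> t _; rewrite -EFinM lee_fin ler_wpM2l// -subr_ge0 -sumrB.
    (* The excess of the sum of squares around the true mean is exactly [n] times the squared error
       of the sample mean. *)
    rewrite (_ : \sum_(i < n) _ = n%:R * (mean_diff j k t - delta j k) ^+ 2).
      by rewrite mulr_ge0 ?sqr_ge0.
    have -> : n%:R * (mean_diff j k t - delta j k) ^+ 2 =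
      (mean_diff j k t - delta j k) * (2 * (n%:R * mean_diff j k t)
         - n%:R * (mean_diff j k t + delta j k)) by ring.
    have -> : n%:R * mean_diff j k t = \sum_(i < n) coord_diff j k (tnth t i).
      by rewrite /mean_diff mulrA divff// mul1r.
    have -> : n%:R * (mean_diff j k t + delta j k) =
        \sum_(i < n) (mean_diff j k t + delta j k).
      by rewrite sumr_const card_ord mulr_natl.
    rewrite mulr_sumr -sumrB mulr_sumr.
    by apply: eq_bigr => i _; rewrite /f; ring.
rewrite ge0_integralZl//; last 2 first.
- by apply/measurable_EFinP; exact: mS.
- by move=> t _; rewrite lee_fin sumr_ge0.
rewrite integral_iid_sum//.
rewrite -mule_natl.
apply: (@le_trans _ _ ((n.-1)%:R^-1%:E * (n%:R%:E * (4 * expR 1 * sigma ^+ 2)%:E))%E).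
  by rewrite lee_wpmul2l ?lee_fin ?invr_ge0// lee_wpmul2l ?lee_fin//; exact: subgaussian_variance.
rewrite -!EFinM lee_fin.
have m0 : 0 < (n.-1)%:R :> R by rewrite ltr0n -ltnS prednK// (ltn_trans _ n1).
rewrite ler_pdivrMl//.
have -> : n%:R = (n.-1)%:R + 1 :> R by rewrite natr1 prednK// (ltn_trans _ n1).
have m1 : 1 <= (n.-1)%:R :> R by rewrite ler1n -ltnS prednK// (ltn_trans _ n1).
have := mulr_ge0 (expR_ge0 1) (sqr_ge0 sigma).
set e := expR 1; set q := sigma ^+ 2; nra.
Qed.
End subgaussian.
End pairwise_differences.

(** * Smallest minimiser over the indices other than [r] *)

Section argmin_theory.
Context (R : realType) (d : nat).
Implicit Types (r k : 'I_d) (F G : 'I_d -> R).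

Lemma sargmin_exceptP r F k0 : k0 != r ->
  sargmin_except r F != r /\
  forall k, k != r -> F (sargmin_except r F) <= F k.
Proof.
move=> k0r; rewrite /sargmin_except.
have [k1 k1r k1P] := arg_minP (P := fun k => k != r) F k0r.
have k1A : k1 \in argmin_except r F.
  rewrite inE k1r; apply/forallP => j; apply/implyP; exact: k1P.
case: pickP => [k /andP[]|].
  rewrite inE => /andP[kr /forallP kP] _ /=.
  by split=> // j; exact/implyP/kP.
(* The least index among the minimisers passes the test of [pick], so the default value is not
   reached. *)
have [k2 k2A k2P] := arg_minnP (fun k : 'I_d => k : nat) k1A.
move=> /(_ k2)/negP[]; apply/andP; split; first exact: k2A.
by apply/forallP => j; apply/implyP; exact: k2P.
Qed.

(** The selected index depends only on the order of the scores. This serves for the plug-in rule and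
    for measurability. *)
Lemma eq_sargmin_except r F G :
  (forall j k, (F j <= F k) = (G j <= G k)) ->
  sargmin_except r F = sargmin_except r G.
Proof.
move=> FG; rewrite /sargmin_except (_ : argmin_except r F = argmin_except r G)//.
by apply/setP => k; rewrite !inE; congr (_ && _); apply: eq_forallb => j; rewrite FG.
Qed.

(** The table of all comparisons takes finitely many values [c], the selection is constant on each
    cell [E c], and so the event is a finite union of cells. *)
Lemma measurable_sargmin_except (dT : measure_display) (T : measurableType dT)
    (r k : 'I_d) (F : 'I_d -> T -> R) :
  (forall j, measurable_fun setT (F j)) ->
  measurable [set x | sargmin_except r (F^~ x) = k].
Proof.
move=> mF; pose E (c : {ffun 'I_d * 'I_d -> bool}) : set T :=
  \bigcap_(p in [set: 'I_d * 'I_d]) [set x | (F p.1 x <= F p.2 x) = c p].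
pose Q c := `[< exists2 x, E c x & sargmin_except r (F^~ x) = k >].
rewrite (_ : mkset _ = [set x | exists2 c, Q c & E c x]).
  apply: measurable_fin_exists => c _; apply: fin_bigcap_measurable => // -[i j] _.
  rewrite -[X in measurable X]setTI.
  by apply: (@measurable_fun_ler _ _ _ setT (F i) (F j) _ _ _ [set c (i, j)]).
apply/seteqP; split => [x xk|x [c /asboolP[y Ey <-] Ex]].
  have Ex : E [ffun p => F p.1 x <= F p.2 x] x by move=> p _ /=; rewrite ffunE.
  by exists [ffun p => F p.1 x <= F p.2 x] => //; apply/asboolP; exists x.
apply: eq_sargmin_except => i j.
by have := Ex (i, j) Logic.I; have := Ey (i, j) Logic.I => /= -> ->.
Qed.

End argmin_theory.

(** * A common form for both selection rules, and the acceptance events *)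

Section score_selection.
Context (R : realType) (d n : nat).
Implicit Types (r k : 'I_d) (t : n.-tuple (d.-tuple R)) (w : (n + n).-tuple (d.-tuple R)).

(** Both rules are instances: [D = 1] gives the plug-in rule and [adj_scale] the adjusted one, so
    the power analysis is done once for a general scale [D]. *)
Definition score_select r (D : 'I_d -> n.-tuple (d.-tuple R) -> R) t : 'I_d :=
  sargmin_except r (fun k => mean_diff k r t / D k t).

Lemma half1_tuple_left w : half1 w = fun i => colv (tnth (tuple_left w) i).
Proof. by apply/funext => i; rewrite tnth_mktuple. Qed.

Lemma half2_tuple_right w : half2 w = fun i => colv (tnth (tuple_right w) i).
Proof. by apply/funext => i; rewrite tnth_mktuple. Qed.

(** Subtracting the sample mean of coordinate [r] from every score preserves their order. *)
Lemma s_plugE r w :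
  s_plug n r w = score_select r (fun _ _ => 1) (tuple_right w).
Proof.
apply: eq_sargmin_except => j k.
by rewrite !divr1 -!sample_mean_diff -half2_tuple_right lerD2r.
Qed.

Definition adj_scale (kappa : R) r k t : R :=
  Num.max (Num.sqrt (var_diff r k t)) kappa.

Lemma s_adjE kappa r w :
  s_adj n kappa r w = score_select r (adj_scale kappa r) (tuple_right w).
Proof.
rewrite /s_adj half2_tuple_right; congr sargmin_except; apply/funext => k.
by rewrite sample_mean_diff qform_sample_cov.
Qed.

(** The index is fixed, not selected, so that this event involves the first half only and
    [iid_left_right] applies to it. *)
Definition accept_at (z : R) r k : set (n.-tuple (d.-tuple R)) :=
  [set t | Num.sqrt n%:R * mean_diff r k t <= z * Num.sqrt (var_diff r k t)].

Lemma rejectionE alpha r s w : rejection n alpha r s w <->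
  ~ accept_at (normal_quantile (1 - alpha)) r (s w) (tuple_left w).
Proof.
rewrite /rejection /accept_at /= half1_tuple_left dotv_gammav sample_mean_diff.
rewrite qform_sample_cov ltNge; split => [/negP//|?]; exact/negP.
Qed.

Lemma measurable_sqrt_var_diff r k :
  measurable_fun setT (fun t => Num.sqrt (var_diff r k t)).
Proof.
apply: (measurableT_comp (f := @Num.sqrt R)).
  by apply: continuous_measurable_fun; exact: sqrt_continuous.
exact: measurable_var_diff.
Qed.

Lemma measurable_accept_at z r k : measurable (accept_at z r k).
Proof.
rewrite -[X in measurable X]setTI /accept_at.
apply: (@measurable_fun_ler _ _ _ setT _ _ _ _ _ [set true]) => //.
  by apply: measurable_funM => //; exact: measurable_mean_diff.
by apply: measurable_funM => //; exact: measurable_sqrt_var_diff.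
Qed.

Lemma measurable_adj_scale kappa r k : measurable_fun setT (adj_scale kappa r k).
Proof. by apply: measurable_maxr => //; exact: measurable_sqrt_var_diff. Qed.

Lemma measurable_score_select r k (D : 'I_d -> n.-tuple (d.-tuple R) -> R) :
  (forall j, measurable_fun setT (D j)) -> (forall j t, 0 < D j t) ->
  measurable [set t | score_select r D t = k].
Proof.
move=> mD D0; apply: measurable_sargmin_except => j.
apply: measurable_funM; first exact: measurable_mean_diff.
(* The inverse agrees with the real power of exponent -1 because [D] is positive. *)
rewrite (_ : (fun _ => _) = (@powR R ^~ (-1)) \o D j).
  by apply: measurableT_comp => //; exact: measurable_powR.
by apply/funext => t /=; rewrite powR_inv1// ltW.
Qed.

End score_selection.

(** * Finite-sample bounds for a bad selection and for a miss *)

Section mu_min_theory.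
Context (R : realType) (d : nat) (P : probability (d.-tuple R) R) (r : 'I_d).

Lemma mu_min_attained : exists k, meanv P k 0 = mu_min r P.
Proof.
rewrite /mu_min; elim/big_ind: _ => [|x y [j <-] [k <-]|k _]; first by exists r.
  by rewrite minElt; case: ifP => _; [exists j|exists k].
by exists k.
Qed.

End mu_min_theory.

Section power.
Context (R : realType) (d n : nat) (sigma : R) (P : probability (d.-tuple R) R).
Variables (r : 'I_d) (kappa M C C' K eta c q : R) (tau : nat).
Variable D : 'I_d -> n.-tuple (d.-tuple R) -> R.
Let mu k := meanv P k 0.
Let gap := mu r - mu_min r P.
Let L := Num.max 1 (ln tau%:R : R).
Hypotheses (n_gt1 : (1 < n)%N) (sigma_gt0 : 0 < sigma).
Hypotheses (c_def : c = kappa / (4 * M)) (q_def : q = c ^+ 2 * K ^+ 2 / (32 * sigma ^+ 2)).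
Hypothesis (subP : subgaussian sigma P).
Hypotheses (kappa_gt0 : 0 < kappa) (kappa_le : kappa <= M).
Hypotheses (mD : forall k, measurable_fun setT (D k)).
Hypotheses (D_ge : forall k t, kappa <= D k t).
Hypothesis (D_le : forall k, k != r -> (iid P n [set t | M < D k t]%R <= eta%:E)%E).
Hypotheses (K_gt0 : 0 < K) (KC : K <= C) (KC' : K <= C') (q_ge1 : 1 <= q).
Hypothesis (gap_ge : C' * eps_star R n tau <= gap).
Hypothesis (card_conf : #|confusion_set n C r P| = tau).

Let M_gt0 : 0 < M. Proof. exact: lt_le_trans kappa_le. Qed.
Let c_gt0 : 0 < c. Proof. by rewrite c_def divr_gt0 ?mulr_gt0. Qed.
Let c_le : c <= 4^-1.
Proof. by rewrite c_def ler_pdivrMr ?mulr_gt0// mulrA mulVf// mul1r. Qed.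
Let n_gt0 : 0 < n%:R :> R. Proof. by rewrite ltr0n (ltn_trans _ n_gt1). Qed.
Let L_ge1 : 1 <= L. Proof. by rewrite le_max lexx. Qed.
Let s2_gt0 : 0 < sigma ^+ 2. Proof. by rewrite exprn_gt0. Qed.
Let D_gt0 k t : 0 < D k t. Proof. exact: lt_le_trans (D_ge _ _). Qed.

Let gap_gt0 : 0 < gap.
Proof.
apply: lt_le_trans gap_ge; apply: mulr_gt0; first exact: lt_le_trans KC'.
by rewrite /eps_star sqrtr_gt0 divr_gt0// (lt_le_trans _ L_ge1).
Qed.

Let n_gap : C' ^+ 2 * L <= n%:R * gap ^+ 2.
Proof.
have e0 : 0 <= eps_star R n tau by exact: sqrtr_ge0.
have C0 : 0 <= C' by rewrite ltW// (lt_le_trans K_gt0).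
have := ler_pM (mulr_ge0 C0 e0) (mulr_ge0 C0 e0) gap_ge gap_ge.
rewrite -!expr2 exprMn /eps_star sqr_sqrtr; last by rewrite divr_ge0 ?(le_trans _ L_ge1)// ltW.
rewrite -/L mulrA ler_pdivrMr//; lra.
Qed.

(** The constant 32 is chosen so that a deviation of [c * gap / 2] has a Chernoff exponent equal to
    twice the right-hand side, hence at least [2 * q * L >= q + L]: enough for a factor [expR (- q)]
    and for a union bound over the confusion set. The number [K] bounds both [C] and [C'] from
    below. *)
Let q_gap : q * L <= n%:R * (c * gap) ^+ 2 / (32 * sigma ^+ 2).
Proof.
rewrite q_def mulrAC ler_pM2r ?invr_gt0 ?mulr_gt0//.
have -> : n%:R * (c * gap) ^+ 2 = c ^+ 2 * (n%:R * gap ^+ 2) by ring.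
rewrite -mulrA ler_pM2l ?exprn_gt0//.
apply: le_trans n_gap; rewrite ler_wpM2r ?(le_trans _ L_ge1)//.
by rewrite ler_pXn2r// nnegrE ltW// (lt_le_trans K_gt0).
Qed.

Let q_gap1 : q <= n%:R * (c * gap) ^+ 2 / (32 * sigma ^+ 2).
Proof.
apply: le_trans q_gap; rewrite ler_peMr//; exact: le_trans q_ge1.
Qed.

Let q_C : q <= (c * C) ^+ 2 / (32 * sigma ^+ 2).
Proof.
rewrite q_def ler_pM2r ?invr_gt0 ?mulr_gt0// exprMn ler_pM2l ?exprn_gt0//.
by rewrite ler_pXn2r// nnegrE ltW// (lt_le_trans K_gt0).
Qed.

Let bad k := (k != r) && (mu r - mu k < c * gap).

(** The share of index [k] in the union bound, once the common factor [expR (- q)] is taken out. *)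
Let weight k : R := if k \in confusion_set n C r P then expR (- L) else d%:R^-1.

(* A bad coordinate lies at distance [a >= gap / 2] above the minimum, and
   looking as good as [2 c gap] requires a deviation of size [c a]. *)
Lemma bad_score_tail k : bad k ->
  (iid P n [set t | 2 * c * gap <= mean_diff r k t]%R <=
   (expR (- q) * weight k)%:E)%E.
Proof.
move=> /andP[kr kb]; pose a := mu k - mu_min r P.
have muE : mu r - mu k = gap - a by rewrite /gap /a; ring.
have a1 : (1 - c) * gap < a by move: kb; rewrite muE; lra.
have a2 : gap / 2 <= a by move: a1 c_le gap_gt0 => *; nra.
have a0 : 0 < a by apply: lt_le_trans a2; rewrite divr_gt0.
(* The contrast has mean [gap - a], so the right-hand side is the deviation needed to reach
   [2 * c * gap]. *)
have ca : c * a <= 2 * c * gap - (gap - a).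
  rewrite -subr_ge0; have -> : 2 * c * gap - (gap - a) - c * a =
    (1 - c) * (a - (1 - c) * gap) + c ^+ 2 * gap by ring.
  apply: addr_ge0; last exact: mulr_ge0 (sqr_ge0 c) (ltW gap_gt0).
  by apply: mulr_ge0; [move: c_le; lra|rewrite subr_ge0 ltW].
apply: (@le_trans _ _ (iid P n
    [set t | c * a <= mean_diff r k t - (meanv P r 0 - meanv P k 0)]%R)).
  apply: le_probability.
  - rewrite -[X in measurable X]setTI.
    apply: (@measurable_fun_ler _ _ _ setT _ _ _ _ _ [set true]) => //.
    exact: measurable_mean_diff.
  - rewrite -[X in measurable X]setTI.
    apply: (@measurable_fun_ler _ _ _ setT _ _ _ _ _ [set true]) => //.
    by apply: measurable_funB => //; exact: measurable_mean_diff.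
  - by move=> t /= h; rewrite -/(mu r) -/(mu k) muE; lra.
rewrite eq_sym in kr.
apply: le_trans (mean_diff_tail sigma_gt0 subP _ kr _) _; first exact: ltn_trans n_gt1.
  exact: mulr_gt0.
rewrite lee_fin.
have q0 : 0 <= q by exact: le_trans q_ge1.
(* Since [a >= gap / 2], the Chernoff exponent is at least twice the quantity bounded in [q_gap]. *)
have h1 : 8 * (n%:R * (c * gap) ^+ 2 / (32 * sigma ^+ 2)) <= 4 * (n%:R * (c * a) ^+ 2 / (4 * sigma ^+ 2)).
  have -> : 8 * (n%:R * (c * gap) ^+ 2 / (32 * sigma ^+ 2)) =
     4 * (n%:R * (c * (gap / 2)) ^+ 2 / (4 * sigma ^+ 2)) by field; rewrite gt_eqF.
  rewrite ler_pM2l// ler_pM2r ?invr_gt0 ?mulr_gt0// ler_pM2l// ler_pXn2r ?ler_pM2l//.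
  - by rewrite nnegrE mulr_ge0 ?(ltW c_gt0)// divr_ge0// ltW.
  - by rewrite nnegrE mulr_ge0 ?(ltW c_gt0)// ltW.
rewrite /weight; case: ifPn => kconf.
  rewrite -expRD ler_expR.
  have : q + L <= 2 * (q * L) by move: q_ge1 L_ge1 => *; nra.
  by move: q_gap h1; lra.
(* Outside the confusion set, [a >= gap / 2] leaves two cases: [k] minimises the mean among the
   candidates, which [a > 0] excludes, or [a] exceeds the upper limit of the set. *)
have aC : C ^+ 2 * ln d%:R <= n%:R * a ^+ 2.
  have {}kconf : C * Num.sqrt (ln d%:R / n%:R) < a.
    move: kconf; rewrite inE !negb_and.
    rewrite eq_sym kr /= negbK -/gap -/(mu k) -/a a2 /= ltNge.
    case/orP => // /[!inE]; case/andP => _ /forallP kmin.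
    have [k0 k0E] := mu_min_attained P r.
    have k0r : k0 != r.
      by apply/eqP => k0r; move: gap_gt0; rewrite /gap -k0E /mu k0r subrr ltxx.
    have /implyP/(_ k0r) := kmin k0; rewrite k0E => ak.
    by move: a0; rewrite /a ltNge subr_le0 ak.
  have dl : 0 <= ln d%:R :> R.
    by rewrite ln_ge0// ler1n (leq_ltn_trans _ (ltn_ord r)).
  have C0 : 0 <= C by rewrite ltW// (lt_le_trans K_gt0).
  have s0 : 0 <= C * Num.sqrt (ln d%:R / n%:R) by rewrite mulr_ge0 ?sqrtr_ge0.
  have := ler_pM s0 s0 (ltW kconf) (ltW kconf).
  rewrite -!expr2 exprMn sqr_sqrtr; last by rewrite divr_ge0// ltW.
  by rewrite mulrA ler_pdivrMr// => h; rewrite mulrC in h; lra.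
have d0 : 0 < d%:R :> R by rewrite ltr0n (leq_ltn_trans _ (ltn_ord r)).
rewrite -(lnK d0) -expRN -expRD ler_expR.
have dl : 0 <= ln d%:R :> R.
  by rewrite ln_ge0// ler1n (leq_ltn_trans _ (ltn_ord r)).
(* One half of the Chernoff exponent pays for [q] through [h1] and [q_gap1], the other half for
   [ln d] through this bound. *)
have h2 : 8 * (q * ln d%:R) <= n%:R * (c * a) ^+ 2 / (4 * sigma ^+ 2).
  apply: (@le_trans _ _ ((c * C) ^+ 2 / (4 * sigma ^+ 2) * ln d%:R)).
    rewrite mulrA ler_wpM2r//.
    have -> : (c * C) ^+ 2 / (4 * sigma ^+ 2) = 8 * ((c * C) ^+ 2 / (32 * sigma ^+ 2)).
      by field; rewrite gt_eqF.
    by rewrite ler_pM2l.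
  rewrite mulrAC ler_pM2r ?invr_gt0 ?mulr_gt0//.
  have -> : n%:R * (c * a) ^+ 2 = c ^+ 2 * (n%:R * a ^+ 2) by ring.
  by rewrite exprMn -mulrA ler_pM2l ?exprn_gt0.
have : ln d%:R <= q * ln d%:R by rewrite ler_peMl.
by move: h1 h2 q_gap1; lra.
Qed.

(** The [tau] confused indices weigh [expR (- L) <= 1 / tau] each and the at most [d] others [1 / d]
    each; either group adds up to at most 1. *)
Lemma sum_weight : \sum_(k | bad k) weight k <= 2.
Proof.
have w0 k : 0 <= weight k by rewrite /weight; case: ifP; rewrite ?expR_ge0 ?invr_ge0.
apply: (@le_trans _ _ (\sum_k weight k)).
  by rewrite [leRHS](bigID bad)/= lerDl sumr_ge0.
rewrite (bigID (mem (confusion_set n C r P)))/= -[2]/(1 + 1); apply: lerD.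
  rewrite (eq_bigr (fun=> expR (- L))); last by move=> k kc; rewrite /weight kc.
  rewrite sumr_const card_conf -mulr_natl expRN ler_pdivrMr ?expR_gt0// mul1r.
  have [->|t0] := posnP tau; first by rewrite expR_ge0.
  by rewrite -[leLHS]lnK ?posrE ?ltr0n// ler_expR le_max lexx orbT.
rewrite (eq_bigr (fun=> d%:R^-1)); last by move=> k kc; rewrite /weight (negbTE kc).
have d0 : (0 < d)%N by exact: leq_ltn_trans (ltn_ord r).
apply: (@le_trans _ _ (\sum_(k < d) d%:R^-1)).
  by rewrite [leRHS](bigID (mem (confusion_set n C r P)))/= lerDr sumr_ge0//.
by rewrite sumr_const card_ord -[_^-1 *+ _]mulr_natl divff// pnatr_eq0 -lt0n.
Qed.

Let expRNq_ge0 : 0 <= expR (- q). Proof. exact: expR_ge0. Qed.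

Lemma measurable_bad_select : measurable [set t | bad (score_select r D t)].
Proof.
rewrite (_ : mkset _ = [set t | exists2 k, bad k & score_select r D t = k]).
  by apply: measurable_fin_exists => k _; exact: measurable_score_select.
by apply/seteqP; split => [t bt|t [k bk tk]]; [exists (score_select r D t)|rewrite /= tk].
Qed.

(** Outside the events [A1], [A2] and [A3], the minimiser [k0] has score below [- gap / (2 * M)],
    while every bad index has score above [- 2 * c * gap / kappa]. These two thresholds coincide, so
    no bad index is selected. *)
Lemma bad_select_le :
  (iid P n [set t | bad (score_select r D t)] <= (eta + 3 * expR (- q))%:E)%E.
Proof.
have [k0 k0E] := mu_min_attained P r.
(* A global minimiser of the mean differs from [r] because [gap] is positive, so it is a
   candidate. *)
have k0r : k0 != r.
  by apply/eqP => k0r; move: gap_gt0; rewrite /gap -k0E /mu k0r subrr ltxx.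
have delta0 : meanv P k0 0 - meanv P r 0 = - gap by rewrite k0E /gap /mu opprB.
pose A1 := [set t | M < D k0 t].
pose A2 := [set t : n.-tuple (d.-tuple R) |
  gap / 2 <= mean_diff k0 r t - (meanv P k0 0 - meanv P r 0)].
pose A3 := [set t : n.-tuple (d.-tuple R) |
  exists2 k, bad k & 2 * c * gap <= mean_diff r k t].
have mA1 : measurable A1.
  rewrite -[X in measurable X]setTI.
  by apply: (@measurable_fun_ltr _ _ _ setT _ _ _ _ _ [set true]).
have mA2 : measurable A2.
  rewrite -[X in measurable X]setTI.
  apply: (@measurable_fun_ler _ _ _ setT _ _ _ _ _ [set true]) => //.
  by apply: measurable_funB => //; exact: measurable_mean_diff.
have mA3k k : measurable [set t : n.-tuple (d.-tuple R) | 2 * c * gap <= mean_diff r k t].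
  rewrite -[X in measurable X]setTI.
  apply: (@measurable_fun_ler _ _ _ setT _ _ _ _ _ [set true]) => //.
  exact: measurable_mean_diff.
have mA3 : measurable A3 by apply: measurable_fin_exists => k _; exact: mA3k.
apply: (@le_trans _ _ (iid P n (A1 `|` (A2 `|` A3)))).
  apply: le_probability; [exact: measurable_bad_select| |].
    by apply: measurableU => //; exact: measurableU.
  move=> t /= bt; have [_ /(_ _ k0r)] := sargmin_exceptP (fun k => mean_diff k r t / D k t) k0r.
  rewrite -/(score_select r D t); set s := score_select r D t in bt *.
  rewrite ler_pdivrMr// mulrAC ler_pdivlMr// => cross.
  have [|D0] := ltP M (D k0 t); first by left.
  have [|m0] := leP (gap / 2) (mean_diff k0 r t - (meanv P k0 0 - meanv P r 0)).
    by right; left.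
  have [|ms] := leP (2 * c * gap) (mean_diff r s t); first by right; right; exists s.
  exfalso; rewrite delta0 in m0; rewrite mean_diffC in cross.
  (* This identity dictates the choice [c = kappa / (4 * M)]. *)
  have cE : 2 * c * M = kappa / 2 by rewrite c_def; field; rewrite gt_eqF.
  have h1 : mean_diff r s t * D k0 t < 2 * c * gap * D k0 t by rewrite ltr_pM2r.
  have h2 : 2 * c * gap * D k0 t <= 2 * c * gap * M.
    by rewrite ler_pM2l// !mulr_gt0.
  have h3 : 2 * c * gap * M <= D s t * gap / 2.
    rewrite mulrAC cE; have := ler_wpM2r (ltW gap_gt0) (D_ge s t); lra.
  have h4 : mean_diff k0 r t * D s t < - (gap / 2) * D s t.
    by rewrite ltr_pM2r//; lra.
  lra.
apply: (le_trans (measureU2 _ mA1 (measurableU _ _ mA2 mA3))).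
rewrite EFinD; apply: leeD; first exact: D_le.
apply: (le_trans (measureU2 _ mA2 mA3)).
(* One term is for [A2]; the two others come from [sum_weight]. *)
rewrite (_ : 3 * expR (- q) = expR (- q) + expR (- q) * 2); last by ring.
rewrite EFinD; apply: leeD.
  apply: le_trans (mean_diff_tail sigma_gt0 subP _ k0r _) _.
  - exact: ltn_trans n_gt1.
  - by rewrite divr_gt0.
  rewrite lee_fin ler_expR lerN2; apply: (le_trans q_gap1).
  have -> : n%:R * (gap / 2) ^+ 2 / (4 * sigma ^+ 2) =
      n%:R * (2 * gap ^+ 2) / (32 * sigma ^+ 2) by field; rewrite gt_eqF.
  rewrite ler_pM2r ?invr_gt0 ?mulr_gt0// ler_pM2l// exprMn ler_pM2r ?exprn_gt0//.
  by move: c_gt0 c_le => *; nra.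
apply: (le_trans (union_bound _ _)) => [k _|]; first exact: mA3k.
apply: (@le_trans _ _ (\sum_(k | bad k) (expR (- q) * weight k)%:E)%E).
  by apply: lee_sum => k; exact: bad_score_tail.
by rewrite sumEFin -mulr_sumr lee_fin ler_wpM2l// sum_weight.
Qed.

(** Acceptance requires the contrast to fall short of its mean by [h], half the guaranteed signal,
    or the studentised threshold to reach [Num.sqrt n * h]. The first is a Chernoff event, the
    second a Markov event for the sample variance. *)
Lemma accept_at_le z k : k != r -> c * gap <= mu r - mu k ->
  (iid P n (accept_at z r k) <= (expR (- q) + expR 1 * z ^+ 2 / q)%:E)%E.
Proof.
move=> kr kg; pose h := c * gap / 2.
have h0 : 0 < h by rewrite divr_gt0 ?mulr_gt0.
have q0 : 0 < q by exact: lt_le_trans q_ge1.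
pose A1 := [set t : n.-tuple (d.-tuple R) |
  h <= mean_diff k r t - (meanv P k 0 - meanv P r 0)].
pose A2 := [set t : n.-tuple (d.-tuple R) |
  n%:R * h ^+ 2 <= z ^+ 2 * var_diff r k t].
have mA1 : measurable A1.
  rewrite -[X in measurable X]setTI.
  apply: (@measurable_fun_ler _ _ _ setT _ _ _ _ _ [set true]) => //.
  by apply: measurable_funB => //; exact: measurable_mean_diff.
have mv : measurable_fun setT (fun t : n.-tuple (d.-tuple R) => z ^+ 2 * var_diff r k t).
  by apply: measurable_funM => //; exact: measurable_var_diff.
have mA2 : measurable A2.
  rewrite -[X in measurable X]setTI.
  by apply: (@measurable_fun_ler _ _ _ setT _ _ _ _ _ [set true]).
apply: (@le_trans _ _ (iid P n (A1 `|` A2))).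
  apply: le_probability; [exact: measurable_accept_at|exact: measurableU|].
  move=> t; rewrite /accept_at /A1 /A2 /= => acc.
  have [|m1] := leP h (mean_diff k r t - (meanv P k 0 - meanv P r 0)); first by left.
  right; rewrite mean_diffC in m1.
  have m2 : h < mean_diff r k t.
    by move: kg m1; rewrite /mu /h; lra.
  have sn : 0 <= Num.sqrt n%:R :> R by exact: sqrtr_ge0.
  have m3 : Num.sqrt n%:R * h <= z * Num.sqrt (var_diff r k t).
    by apply: le_trans acc; rewrite ler_wpM2l// ltW.
  have m4 : 0 <= Num.sqrt n%:R * h by rewrite mulr_ge0// ltW.
  (* The smaller side is nonnegative, so squaring is legitimate whatever the sign of [z]. *)
  have := ler_pM m4 m4 m3 m3.
  by rewrite -!expr2 !exprMn !sqr_sqrtr// ?var_diff_ge0// ltW.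
apply: (le_trans (measureU2 _ mA1 mA2)); rewrite EFinD; apply: leeD.
  apply: le_trans (mean_diff_tail sigma_gt0 subP _ kr h0) _.
    exact: ltn_trans n_gt1.
  rewrite lee_fin ler_expR lerN2; apply: (le_trans q_gap1).
  have -> : n%:R * h ^+ 2 / (4 * sigma ^+ 2) =
      2 * (n%:R * (c * gap) ^+ 2 / (32 * sigma ^+ 2)).
    by rewrite /h; field; rewrite gt_eqF.
  by move: q_gap1; lra.
have nh0 : 0 < n%:R * h ^+ 2 by rewrite mulr_gt0 ?exprn_gt0.
apply: (le_trans (markov_ineq (iid P n) mv _ nh0)).
  by move=> t; rewrite mulr_ge0 ?sqr_ge0 ?var_diff_ge0.
under eq_integral do rewrite EFinM.
rewrite ge0_integralZl//; last 3 first.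
- by apply/measurable_EFinP; exact: measurable_var_diff.
- by move=> t _; rewrite lee_fin var_diff_ge0.
- by rewrite lee_fin sqr_ge0.
rewrite eq_sym in kr.
apply: (@le_trans _ _ ((n%:R * h ^+ 2)^-1%:E *
   ((z ^+ 2)%:E * (8 * expR 1 * sigma ^+ 2)%:E))%E).
  rewrite lee_wpmul2l ?lee_fin ?invr_ge0 ?(ltW nh0)//.
  rewrite lee_wpmul2l ?lee_fin ?sqr_ge0//.
  exact: integral_var_diff.
rewrite -!EFinM lee_fin ler_pdivrMl// [leRHS]mulrA ler_pdivlMr//.
have -> : n%:R * h ^+ 2 * (expR 1 * z ^+ 2) =
    (expR 1 * z ^+ 2 * (8 * sigma ^+ 2)) * (n%:R * (c * gap) ^+ 2 / (32 * sigma ^+ 2)).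
  by rewrite /h; field; rewrite gt_eqF.
rewrite [leLHS](_ : _ = (expR 1 * z ^+ 2 * (8 * sigma ^+ 2)) * q); last by ring.
apply: ler_wpM2l; last exact: q_gap1.
by apply: mulr_ge0; [rewrite mulr_ge0 ?expR_ge0 ?sqr_ge0|rewrite mulr_ge0 ?(ltW s2_gt0)].
Qed.

Lemma rejection_measurable alpha :
  measurable (rejection n alpha r (fun w => score_select r D (tuple_right w))).
Proof.
set z := normal_quantile (1 - alpha).
rewrite -[X in measurable X]setCK; apply: measurableC.
rewrite (_ : ~` _ = [set w | exists2 k, xpredT k &
    accept_at z r k (tuple_left w) /\ score_select r D (tuple_right w) = k]).
  apply: measurable_fin_exists => k _; apply: measurableI.
    rewrite -[X in measurable X]setTI.
    exact: (measurable_tuple_left _ (measurable_accept_at _ _ _)).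
  rewrite -[X in measurable X]setTI.
  exact: (measurable_tuple_right _ (measurable_score_select r k mD D_gt0)).
apply/seteqP; split => [w /= nw|w [k _ [ak wk]]] /=.
  exists (score_select r D (tuple_right w)) => //; split => //.
  by apply: contrapT => aw; apply: nw; apply/rejectionE.
by move/rejectionE; rewrite wk.
Qed.

Lemma power_bound alpha (z := normal_quantile (1 - alpha)) :
  (1 - (eta + (4 + expR 1 * z ^+ 2) / q)%:E <=
   iid P (n + n) (rejection n alpha r (fun w => score_select r D (tuple_right w))))%E.
Proof.
set Rj := rejection _ _ _ _; have mRj : measurable Rj by exact: rejection_measurable.
have q0 : 0 < q by exact: lt_le_trans q_ge1.
pose beta := expR (- q) + expR 1 * z ^+ 2 / q.
have beta0 : 0 <= beta.
  apply: addr_ge0 => //; apply: divr_ge0; last exact: ltW.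
  by apply: mulr_ge0; [exact: expR_ge0|exact: sqr_ge0].
(* This merges the four exponentials, three from the selection and one from acceptance, into
   [4 / q]. *)
have eq1 : expR (- q) <= q^-1.
  rewrite expRN lef_pV2 ?posrE ?expR_gt0//; have := expR_ge1Dx q; lra.
suff : (iid P (n + n) (~` Rj) <= (eta + 3 * expR (- q) + beta)%:E)%E.
  rewrite probability_setC// => h.
  have fR : iid P (n + n) Rj \is a fin_num by exact: fin_num_measure.
  rewrite -(fineK fR) -!EFinB lee_fin in h *; rewrite lee_fin.
  have : eta + 3 * expR (- q) + beta <= eta + (4 + expR 1 * z ^+ 2) / q.
    by rewrite mulrDl /beta; lra.
  by move: h; lra.
pose B := [set w : (n + n).-tuple (d.-tuple R) | bad (score_select r D (tuple_right w))].
pose G k := [set w : (n + n).-tuple (d.-tuple R) |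
    accept_at z r k (tuple_left w) /\ score_select r D (tuple_right w) = k].
have mB : measurable B.
  rewrite -[X in measurable X]setTI.
  exact: (measurable_tuple_right _ measurable_bad_select).
have mG k : measurable (G k).
  apply: measurableI.
    rewrite -[X in measurable X]setTI.
    exact: (measurable_tuple_left _ (measurable_accept_at _ _ _)).
  rewrite -[X in measurable X]setTI.
  exact: (measurable_tuple_right _ (measurable_score_select r k mD D_gt0)).
pose good k := (k != r) && ~~ bad k.
have mS k : measurable [set t | score_select r D t = k].
  exact: measurable_score_select.
apply: (@le_trans _ _ (iid P (n + n) (B `|` [set w | exists2 k, good k & G k w]))).
  apply: le_probability; first exact: measurableC.
    by apply: measurableU => //; apply: measurable_fin_exists.
  move=> w /= nw.
  have aw : accept_at z r (score_select r D (tuple_right w)) (tuple_left w).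
    by apply: contrapT => aw; apply: nw; apply/rejectionE.
  have [|nb] := boolP (bad (score_select r D (tuple_right w))); first by left.
  right; exists (score_select r D (tuple_right w)); last by split.
  rewrite /good nb andbT.
  have [k0 k0E] := mu_min_attained P r.
  have k0r : k0 != r.
    by apply/eqP => k0r; move: gap_gt0; rewrite /gap -k0E /mu k0r subrr ltxx.
  by have [] := sargmin_exceptP (fun k => mean_diff k r (tuple_right w) / D k (tuple_right w)) k0r.
apply: (le_trans (measureU2 _ mB _)); first exact: measurable_fin_exists.
rewrite EFinD; apply: leeD.
  (* A bad selection involves the second half only: take the whole space as the event on the first
     half. *)
  have := iid_left_right P (@measurableT _ (n.-tuple (d.-tuple R))) measurable_bad_select.
  rewrite probability_setT mul1e (_ : mkset _ = B) => [BE|].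
    by have := bad_select_le; rewrite -BE.
  by apply/seteqP; split => w //= [].
apply: (le_trans (union_bound _ _)) => //.
(* Independence makes each term a product whose acceptance factor is at most [beta]; the selection
   events are disjoint, so their probabilities sum to at most 1. *)
apply: (@le_trans _ _ (\sum_(k | good k) iid P n [set t | score_select r D t = k] * beta%:E)%E).
  apply: lee_sum => k /andP[kr]; rewrite /bad kr -leNgt => kg.
  rewrite (iid_left_right P (measurable_accept_at z r k) (mS k)) muleC.
  by rewrite lee_wpmul2l//; exact: accept_at_le.
apply: (@le_trans _ _ (\sum_(k < d) iid P n [set t | score_select r D t = k] * beta%:E)%E).
  rewrite [leRHS](bigID good)/= leeDl// sume_ge0// => k _.
  by rewrite mule_ge0// lee_fin.
rewrite -ge0_sume_distrl; last by move=> k _.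
rewrite -measure_semi_additive_ord//.
- rewrite -[leRHS]mul1e lee_wpmul2r ?lee_fin//; apply: probability_le1.
  by apply: bigsetU_measurable.
- by apply/trivIsetP => i j _ _ ij; apply/seteqP; split => t //= [-> /eqP]; rewrite (negbTE ij).
- by apply: bigsetU_measurable.
Qed.

End power.

(** * Passage to the limit, uniformly over the class *)

(** The infimum always lies between 0 and 1, so a lower bound uniform in [P] suffices; an empty
    class satisfies it by convention. *)
Lemma cvg_inf_prob (R : realType) (d m : nat -> nat)
    (Cl : forall n, set (probability ((d n).-tuple R) R))
    (A : forall n, set ((m n).-tuple ((d n).-tuple R))) :
  (forall n, measurable (A n)) ->
  (forall e : R, 0 < e -> \forall n \near \oo,
     forall P, Cl n P -> (1 - e%:E <= iid P (m n) (A n))%E) ->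
  inf_prob (Cl n) (A n) @[n --> \oo] --> 1%E.
Proof.
move=> mA lbA.
have le1 n : (inf_prob (Cl n) (A n) <= 1)%E.
  rewrite /inf_prob; case: ifPn => // /set0P[P CP].
  apply: le_trans (probability_le1 (iid P (m n)) (mA n)).
  by apply: ereal_inf_lbound; exists P.
have ge0 n : (0 <= inf_prob (Cl n) (A n))%E.
  by rewrite /inf_prob; case: ifPn => // _; apply: le_ereal_inf_tmp => _ [P _ <-].
have fin n : inf_prob (Cl n) (A n) \is a fin_num.
  by rewrite ge0_fin_numE// (le_lt_trans (le1 n)) ?ltry.
apply/fine_cvgP; split; first by apply: nearW => n; exact: fin.
apply/cvgrPdist_le => e e0; near=> n.
have h : (1 - e%:E <= inf_prob (Cl n) (A n))%E.
  rewrite /inf_prob; case: ifPn => [_|_].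
    by rewrite -EFinB lee_fin lerBlDr lerDl ltW.
  apply: le_ereal_inf_tmp => _ [P CP <-].
  by move: P CP; near: n; exact: lbA.
have := le1 n; move: h => /=; rewrite -{1 2}(fineK (fin n)) -EFinB !lee_fin => h1 h2.
by rewrite ger0_norm ?subr_ge0//; lra.
Unshelve. all: by end_near. Qed.

(** The scale need only be bounded above in probability, by an [M] that depends on [e] but not on
    [n], the index or [P]. Hence [c], [q] and [K] are fixed before [n] grows, and [C] and [C']
    eventually exceed [K]. *)
Lemma score_power_cvg (R : realType) (alpha sigma kappa : R)
  (hsigma : 0 < sigma) (hkappa : 0 < kappa)
  (C : nat -> R) (hC : C n @[n --> \oo] --> +oo)
  (d : nat -> nat) (r : forall n, 'I_(d n)) (tau : nat -> nat)
  (C' : nat -> R) (hC' : C' n @[n --> \oo] --> +oo)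
  (eps : nat -> R)
  (heps : forall n, C' n * eps_star R n (tau n) <= eps n)
  (D : forall n, 'I_(d n) -> n.-tuple ((d n).-tuple R) -> R) :
  (forall n k, measurable_fun setT (D n k)) ->
  (forall n k t, kappa <= D n k t) ->
  (forall e : R, 0 < e -> exists2 M, kappa <= M & forall n P k, (1 < n)%N ->
    subgaussian sigma P -> k != r n -> (iid P n [set t | M < D n k t]%R <= e%:E)%E) ->
  inf_prob (alternatives n sigma (C n) (r n) (eps n) (tau n))
     (rejection n alpha (r n) (fun w => score_select (r n) (D n) (tuple_right w)))
    @[n --> \oo] --> 1%E.
Proof.
move=> mD D_ge D_le; apply: (@cvg_inf_prob R d (fun n => (n + n)%N)) => [n|e e0].
  exact: rejection_measurable hkappa (mD n) (D_ge n) _.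
have [M kM D_leM] := D_le _ (divr_gt0 e0 (ltr0n R 2)).
have M0 : 0 < M by exact: lt_le_trans kM.
set z := normal_quantile (1 - alpha).
pose c := kappa / (4 * M).
have c0 : 0 < c by rewrite divr_gt0 ?mulr_gt0.
pose B := 4 + expR 1 * z ^+ 2.
have B0 : 0 < B by apply: ltr_pwDl => //; exact: mulr_ge0 (expR_ge0 _) (sqr_ge0 _).
(* Chosen so that [B / q <= e / 2]; the other half of [e] is spent on the scale exceeding [M]. *)
pose q := 1 + 2 * B / e.
have q1 : 1 <= q by rewrite lerDl divr_ge0 ?mulr_ge0// ltW.
have q0 : 0 < q by exact: lt_le_trans q1.
(* The positive solution of the equation [q_def]. *)
pose K := Num.sqrt (32 * sigma ^+ 2 * q) / c.
have K0 : 0 < K by rewrite divr_gt0// sqrtr_gt0 !mulr_gt0 ?exprn_gt0.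
have cK : c * K = Num.sqrt (32 * sigma ^+ 2 * q) by rewrite /K mulrC divfK ?gt_eqF.
have q_def : q = c ^+ 2 * K ^+ 2 / (32 * sigma ^+ 2).
  rewrite -exprMn cK sqr_sqrtr.
    by field; rewrite gt_eqF.
  by rewrite !mulr_ge0 ?sqr_ge0// ltW.
near=> n => P [subP gap_eps card_conf].
have KC : K <= C n by near: n; exact: (cvgryPge _).1.
have KC' : K <= C' n by near: n; exact: (cvgryPge _).1.
have n1 : (1 < n)%N by near: n; exact: nbhs_infty_gt.
have := power_bound n1 hsigma erefl q_def subP hkappa kM (mD n) (D_ge n)
  (fun k => D_leM n P k n1 subP) K0 KC KC' q1 (le_trans (heps n) gap_eps) card_conf alpha.
apply: le_trans; rewrite -!EFinB lee_fin lerD2l lerN2.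
have : B / q <= e / 2.
  rewrite ler_pdivrMr// /q mulrDr mulr1 (_ : e / 2 * (2 * B / e) = B).
    by rewrite lerDr divr_ge0// ltW.
  by field; rewrite gt_eqF.
by rewrite -/z -/B; lra.
Unshelve. all: by end_near. Qed.

Theorem theorem3p1 (R : realType) (alpha sigma kappa : R)
  (halpha : 0 < alpha < 1) (hsigma : 0 < sigma) (hkappa : 0 < kappa)
  (C : nat -> R) (hC0 : forall n, 0 < C n) (hC : C n @[n --> \oo] --> +oo)
  (d : nat -> nat) (hd : forall n, (2 <= d n)%N) (r : forall n, 'I_(d n))
  (tau : nat -> nat) (htau : forall n, (tau n <= d n - 2)%N)
  (C' : nat -> R) (hC'0 : forall n, 0 < C' n) (hC' : C' n @[n --> \oo] --> +oo)
  (eps : nat -> R) (heps0 : forall n, 0 < eps n)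
  (heps : forall n, C' n * eps_star R n (tau n) <= eps n) :
  (inf_prob (alternatives n sigma (C n) (r n) (eps n) (tau n))
     (rejection n alpha (r n) (s_plug n (r n))) @[n --> \oo] --> 1%E) /\
  (inf_prob (alternatives n sigma (C n) (r n) (eps n) (tau n))
     (rejection n alpha (r n) (s_adj n kappa (r n))) @[n --> \oo] --> 1%E).
Proof.
split.
  rewrite (_ : (fun n => _) = fun n => inf_prob
      (alternatives n sigma (C n) (r n) (eps n) (tau n))
      (rejection n alpha (r n)
        (fun w => score_select (r n) (fun _ _ => 1) (tuple_right w)))).
    (* The scale is constantly 1, so 1 serves as lower bound and as [M], and the exceedance event is
       empty. *)
    apply: (score_power_cvg alpha hsigma ltr01 hC hC' heps) => // e e0.
    exists 1 => // n P k _ _ _; rewrite (_ : mkset _ = set0) ?measure0 ?lee_fin ?ltW//.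
    by apply/seteqP; split => t //=; rewrite ltxx.
  apply/funext => n; congr (inf_prob _ (rejection _ _ _ _)).
  by apply/funext => w; exact: s_plugE.
rewrite (_ : (fun n => _) = fun n => inf_prob
    (alternatives n sigma (C n) (r n) (eps n) (tau n))
    (rejection n alpha (r n)
      (fun w => score_select (r n) (adj_scale kappa (r n)) (tuple_right w)))).
  apply: (score_power_cvg alpha hsigma hkappa hC hC' heps).
  - by move=> n k; exact: measurable_adj_scale.
  - by move=> n k t; rewrite /adj_scale le_max lexx orbT.
  - move=> e e0; pose V := 8 * expR 1 * sigma ^+ 2.
    have V0 : 0 <= V by rewrite mulr_ge0 ?sqr_ge0 ?mulr_ge0 ?expR_ge0.
    have Ve : 0 <= V / e by rewrite divr_ge0// ltW.
    (* The term [kappa] ensures that only the standard deviation can push the scale above [M];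
       [M >= 1] and [M >= V / e] give [V <= M ^+ 2 * e], as Markov's inequality requires. *)
    exists (kappa + 1 + V / e) => [|n P k n1 subP kr]; first by lra.
    set M := kappa + 1 + V / e; have M1 : 1 <= M by rewrite /M; lra.
    have M0 : 0 < M by exact: lt_le_trans M1.
    have kM : kappa <= M by rewrite /M; lra.
    apply: (@le_trans _ _ (iid P n [set t | M ^+ 2 <= var_diff (r n) k t]%R)).
      apply: le_probability.
      + rewrite -[X in measurable X]setTI.
        apply: (@measurable_fun_ltr _ _ _ setT _ _ _ _ _ [set true]) => //.
        exact: measurable_adj_scale.
      + rewrite -[X in measurable X]setTI.
        apply: (@measurable_fun_ler _ _ _ setT _ _ _ _ _ [set true]) => //.
        exact: measurable_var_diff.
      + move=> t /=; rewrite /adj_scale lt_max (ltNge M kappa) kM orbF => h.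
        rewrite -(sqr_sqrtr (var_diff_ge0 (r n) k t)).
        by rewrite ler_pXn2r ?nnegrE ?sqrtr_ge0// ltW.
    apply: (le_trans (markov_ineq (iid P n) (measurable_var_diff _ _)
      (var_diff_ge0 _ _) (exprn_gt0 2 M0))).
    rewrite eq_sym in kr.
    apply: (@le_trans _ _ ((M ^+ 2)^-1%:E * V%:E)%E).
      by rewrite lee_wpmul2l ?lee_fin ?invr_ge0 ?sqr_ge0//; exact: integral_var_diff.
    rewrite -EFinM lee_fin ler_pdivrMl ?exprn_gt0//.
    have VM : V <= M * e by rewrite -ler_pdivrMr// /M; lra.
    by apply: (le_trans VM); rewrite ler_pM2r// expr2 ler_peMr// ltW.
apply/funext => n; congr (inf_prob _ (rejection _ _ _ _)).
by apply/funext => w; exact: s_adjE.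
Qed.
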